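(* Let $T\ge 1$ and $n\ge 1$ be integers. For each $t\in\{1,\dots,T\}$ let $L_t:\mathbb{R}^n\times\mathbb{R}^n\to\mathbb{R}\cup\{+\infty\}$ be proper, convex and lower semicontinuous, and let $g:\mathbb{R}^n\to\mathbb{R}\cup\{+\infty\}$ be proper, convex and lower semicontinuous. Let $\vartheta_\tau$ and $\omega_\tau$ be the primal and dual value functions, and $f$, $K_t$ the dual data, defined in the context. Assume that there exists $\{\bar p_t\}_{t=0}^T\subset\mathbb{R}^n$ such that $\bar p_T\in\operatorname{ri}(\operatorname{dom}(f))$ and, for all $t\in\{1,\dots,T\}$, $\bar p_{t-1}\in\operatorname{ri}(\mathbf{P}(t))$ and $\Delta\bar p_t\in\operatorname{ri}(\Gamma_K(t,\bar p_{t-1}))$. Then, for any $\tau\in\{0,\dots,T\}$, $\omega_\tau^*=\vartheta_\tau$. Moreover, the infimum in the definition of $\vartheta_\tau(\xi)$ is attained for any $\xi\in\operatorname{dom}(\vartheta_\tau)$.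
   Context: Notation: for a sequence, $\Delta x_t:=x_t-x_{t-1}$. For an extended-real-valued function $\varphi$, $\operatorname{dom}(\varphi)=\{x:\varphi(x)<+\infty\}$; $\varphi$ is proper if $\operatorname{dom}(\varphi)\ne\emptyset$ and $\varphi>-\infty$ everywhere; $\operatorname{ri}(S)$ is the relative interior of a convex set $S$; the conjugate is $\varphi^*(y)=\sup_x\{x\cdot y-\varphi(x)\}$ (values in $\mathbb{R}\cup\{\pm\infty\}$). Primal value function: for $\tau\in\{0,\dots,T-1\}$ and $\xi\in\mathbb{R}^n$, $$\vartheta_\tau(\xi):=\inf\Big\{\sum_{t=\tau+1}^T L_t(x_{t-1},\Delta x_t)+g(x_T)\ :\ \{x_t\}_{t=\tau}^T\subset\mathbb{R}^n,\ x_\tau=\xi\Big\},$$ and $\vartheta_T(\xi):=g(\xi)$ (for $\tau=T$ no infimum is involved, so attainment is trivial). Dual value function: with $f(b):=g^*(-b)$ and $K_t(p,w):=\sup_{x,v\in\mathbb{R}^n}\{x\cdot w+v\cdot p-L_t(x,v)\}$, for $\tau\in\{0,\dots,T-1\}$ and $\eta\in\mathbb{R}^n$, $$\omega_\tau(\eta):=\inf\Big\{\sum_{t=\tau+1}^T K_t(p_t,\Delta p_t)+f(p_T)\ :\ \{p_t\}_{t=\tau}^T\subset\mathbb{R}^n,\ p_\tau=-\eta\Big\},$$ and $\omega_T(\eta):=f(-\eta)$. Constraint maps: $\Gamma_K(t,p):=\{w\in\mathbb{R}^n: K_t(p+w,w)\in\mathbb{R}\}$ and $\mathbf{P}(t):=\{p\in\mathbb{R}^n:\Gamma_K(t,p)\neq\emptyset\}$.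 *)

(* Defs.v *)
From HB Require Import structures.
From mathcomp Require Import all_boot all_order all_algebra.
From mathcomp Require Import all_classical all_reals all_analysis.

Set Implicit Arguments.
Unset Strict Implicit.
Unset Printing Implicit Defensive.

Import Order.TTheory GRing.Theory Num.Theory.
Import numFieldNormedType.Exports.

Local Open Scope classical_set_scope.
Local Open Scope ring_scope.
Local Open Scope ereal_scope.

Section ConvexAnalysis.
Context {R : realType}.

Definition dot (n : nat) (u v : 'rV[R]_n) : R :=
  (\sum_(i < n) u ord0 i * v ord0 i)%R.

Definition edom (E : Type) (phi : E -> \bar R) : set E :=
  [set x | phi x < +oo].

Definition eproper (E : Type) (phi : E -> \bar R) : Prop :=
  edom phi !=set0 /\ forall x, -oo < phi x.

(* Convexity of the epigraph: no addition of infinities is involved. *)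
Definition econvex (E : lmodType R) (phi : E -> \bar R) : Prop :=
  convex_set ([set z : E * R^o | phi z.1 <= (z.2 : R)%:E]).

Definition conjugate (n : nat) (phi : 'rV[R]_n -> \bar R) (y : 'rV[R]_n)
    : \bar R :=
  ereal_sup (range (fun x => (dot x y)%:E - phi x)).

Definition affine_set (E : lmodType R) (A : set E) : Prop :=
  forall (x y : E) (a : R), A x -> A y -> A ((1 - a) *: x + a *: y)%R.

Definition affine_hull (E : lmodType R) (S : set E) : set E :=
  smallest (@affine_set E) S.

(* [within D (nbhs x)] is the filter of neighbourhoods of [x] relative to
   [D]: some neighbourhood [V] of [x] satisfies [V `&` affine_hull S `<=` S]. *)
Definition relint (E : normedModType R) (S : set E) : set E :=
  [set x | S x /\ within (affine_hull S) (nbhs x) S].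

End ConvexAnalysis.

Section BolzaProblem.
Context {R : realType} (n T : nat).
Local Notation V := 'rV[R]_n.

(* Trajectories are functions [nat -> V]; only their values at times
   [tau, ..., T] enter the constraints and the costs below. *)
Definition delta (x : nat -> V) (t : nat) : V := (x t - x t.-1)%R.

Section Primal.
Variables (L : nat -> V * V -> \bar R) (g : V -> \bar R).

Definition primal_cost (tau : nat) (x : nat -> V) : \bar R :=
  \sum_(tau.+1 <= t < T.+1) L t (x t.-1, delta x t) + g (x T).

Definition primal_value (tau : nat) (xi : V) : \bar R :=
  if (tau < T)%N then
    ereal_inf [set primal_cost tau x | x in [set x | x tau = xi]]
  else g xi.

End Primal.

Section Dual.
Variables (L : nat -> V * V -> \bar R) (g : V -> \bar R).

Definition dual_terminal (b : V) : \bar R := conjugate g (- b)%R.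

Definition dual_lagrangian (t : nat) (p w : V) : \bar R :=
  ereal_sup (range (fun z : V * V =>
    (dot z.1 w + dot z.2 p)%:E - L t z)).

Definition dual_cost (tau : nat) (p : nat -> V) : \bar R :=
  \sum_(tau.+1 <= t < T.+1) dual_lagrangian t (p t) (delta p t)
    + dual_terminal (p T).

Definition dual_value (tau : nat) (eta : V) : \bar R :=
  if (tau < T)%N then
    ereal_inf [set dual_cost tau p | p in [set p | p tau = (- eta)%R]]
  else dual_terminal (- eta)%R.

Definition GammaK (t : nat) (p : V) : set V :=
  [set w | dual_lagrangian t (p + w)%R w \is a fin_num].

Definition PK (t : nat) : set V := [set p | GammaK t p !=set0].

End Dual.

End BolzaProblem.

(* Main.v *)
(* Restricted to finite costs, the dual problem minimizes H(A p) + l(p) over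
   trajectories p, where H is the separable convex function built from the K_t
   and f, A p = (delta p, p, p T) and l is linear. The qualification puts a
   point of the range of A in the relative interior of dom H, so the perturbed
   value function has a subgradient at 0. Summation by parts turns this
   subgradient into a primal trajectory x, and biconjugation, L_t = K_t* and
   g = g**, shows that its cost is at most the conjugate of the dual value.
   The reverse inequality is the Fenchel-Young inequality summed along a pair
   of trajectories. The relative interior is used only through the algebraic
   property that segments ending at the point can be prolonged beyond it. *)

Require Import Defs.
From HB Require Import structures.
From mathcomp Require Import all_boot all_order all_algebra.
From mathcomp Require Import all_classical all_reals all_analysis.
From mathcomp Require Import ring lra zify.
Import Order.TTheory GRing.Theory Num.Theory.
Import numFieldNormedType.Exports.
Local Open Scope classical_set_scope.
Local Open Scope ring_scope.
Local Open Scope ereal_scope.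

(** * Multipliers for convex relations, by finite-dimensional separation *)

Section Separation.
Set Implicit Arguments.
Unset Strict Implicit.
Local Open Scope ring_scope.
Context {R : realType}.

(** [G u r] is to be thought of as [r] bounding an extended-real function at [u]: working with the
    epigraph keeps infinite values out of the separation argument. *)
Definition convex_rel (U : lmodType R) (G : U -> R -> Prop) : Prop :=
  forall u v r s (a b : R), 0 < a -> 0 < b -> a + b = 1 ->
    G u r -> G v s -> G (a *: u + b *: v) (a * r + b * s).

Lemma scalar_comb (U : lmodType R) (c : U -> R) (a b : R) u v :
  scalar c -> c (a *: u + b *: v) = a * c u + b * c v.
Proof.
move=> clin; rewrite clin; congr (_ + _).
have c0 : c 0 = 0 by have := clin (-1) 0 0; rewrite scaler0 addr0; lra.
by rewrite -[b *: v]addr0 clin c0 addr0.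
Qed.

Lemma scalar_sum (U : lmodType R) (I : finType) (c : I -> U -> R) (y : I -> R) :
  (forall i, scalar (c i)) -> scalar (fun u => \sum_i y i * c i u).
Proof.
move=> clin a u v; rewrite mulr_sumr -big_split /=; apply: eq_bigr => i _.
by rewrite clin; ring.
Qed.

(* Finite-dimensional Hahn-Banach by adding one coordinate at a time: the
   admissible values of the new multiplier form a nonempty interval because
   convexity makes every lower bound at most every upper bound, and
   prolongation makes both families of bounds empty or both nonempty. *)
Lemma dominated_functional (U : lmodType R) (I : finType) (c : I -> U -> R)
    (G : U -> R -> Prop) :
  (forall i, scalar (c i)) -> convex_rel G ->
  (forall u r, G u r -> exists2 e, 0 < e & exists s, G (- e *: u) s) ->
  (forall u r, G u r -> (forall i, c i u = 0) -> 0 <= r) ->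
  exists y : I -> R, forall u r, G u r -> \sum_i y i * c i u <= r.
Proof.
move=> clin Gconv Gprol G0.
suff H (s : seq I) : exists y : I -> R, forall u r, G u r ->
    (forall i, i \notin s -> c i u = 0) -> \sum_i y i * c i u <= r.
  have [y Hy] := H (enum I); exists y => u r Gu; apply: Hy => // i.
  by rewrite mem_enum.
elim: s => [|j s [y IH]].
  exists (fun=> 0) => u r Gu cu; rewrite big1 => [|i _]; last by rewrite mul0r.
  by apply: (G0 u) => // i; apply: cu.
pose ok u := forall i, i \notin j :: s -> c i u = 0.
pose l u := \sum_i y i * c i u.
have llin : scalar l by apply: scalar_sum.
have okc a b u v : ok u -> ok v -> ok (a *: u + b *: v).
  by move=> ou ov i si; rewrite scalar_comb// ou// ov// !mulr0 addr0.
have prol u r : G u r -> ok u -> exists v t, [/\ G v t, ok v &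
    exists2 e, 0 < e & c j v = - e * c j u].
  move=> Gu ou; have [e e0 [t Gt]] := Gprol _ _ Gu.
  have cN i : c i (- e *: u) = - e * c i u.
    by rewrite -[_ *: u]addr0 -(scaler0 U 0) scalar_comb// mul0r addr0.
  exists (- e *: u), t; split=> //; last by exists e.
  by move=> i si; rewrite cN ou// mulr0.
have compat u r u' r' : G u r -> ok u -> G u' r' -> ok u' ->
    0 < c j u -> c j u' < 0 -> (r' - l u') / c j u' <= (r - l u) / c j u.
  move=> Gu ou Gu' ou' cu cu'.
  set p := c j u in cu *; set q := c j u' in cu' *.
  have D0 : 0 < p - q by lra.
  (* These weights make the coordinate [j] of the combination vanish, so the induction hypothesis
     applies to it. *)
  pose a := - q / (p - q); pose b := p / (p - q).
  have a0 : 0 < a by apply: divr_gt0 => //; lra.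
  have b0 : 0 < b by apply: divr_gt0.
  have ab : a + b = 1 by rewrite /a /b; field; lra.
  have := IH _ _ (Gconv _ _ _ _ _ _ a0 b0 ab Gu Gu').
  have H : forall i, i \notin s -> c i (a *: u + b *: u') = 0.
    move=> i si; have [->|ij] := eqVneq i j.
      by rewrite scalar_comb// -/p -/q /a /b; field; lra.
    by apply: okc => //; rewrite inE negb_or ij.
  move=> /(_ H); rewrite -/(l _) scalar_comb// => K.
  rewrite ler_pdivlMr// mulrAC ler_ndivrMr//.
  have E : (p - q) * (a * l u + b * l u') = - q * l u + p * l u'.
    by rewrite /a /b; field; lra.
  have F : (p - q) * (a * r + b * r') = - q * r + p * r'.
    by rewrite /a /b; field; lra.
  by have := ler_wpM2l (ltW D0) K; rewrite E F; nra.
pose A := [set a | exists u r, [/\ G u r, ok u, c j u < 0 &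
  a = (r - l u) / c j u]].
have upper u r : G u r -> ok u -> 0 < c j u -> ubound A ((r - l u) / c j u).
  by move=> Gu ou cu _ [v [t [Gv ov cv ->]]]; apply: compat.
(* The multiplier of [j] is shifted rather than replaced because [l] already contains [y j]. If [A]
   is empty, prolongation leaves only points with [c j u = 0], and the value of [sup A] does not
   matter. *)
exists (fun i => y i + (i == j)%:R * sup A) => u r Gu ou.
have -> : \sum_i (y i + (i == j)%:R * sup A) * c i u = l u + sup A * c j u.
  rewrite (eq_bigr (fun i => y i * c i u + (i == j)%:R * (sup A * c i u)));
    last by move=> i _; ring.
  rewrite big_split /=; congr (_ + _).
  rewrite (bigD1 j)//= eqxx mul1r big1 ?addr0// => i /negbTE ->.
  by rewrite mul0r.
rewrite -lerBrDl; have [cu|cu|cu] := ltrgtP (c j u) 0.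
- have [v [t [Gv ov [e e0 cv]]]] := prol _ _ Gu ou.
  rewrite -ler_ndivrMr//; apply: ub_le_sup; last by exists u, r.
  by exists ((t - l v) / c j v); apply: upper => //; rewrite cv; nra.
- have [v [t [Gv ov [e e0 cv]]]] := prol _ _ Gu ou.
  rewrite -ler_pdivlMr//; apply: ge_sup; last exact: upper.
  by exists ((t - l v) / c j v), v, t; split=> //; rewrite cv; nra.
- rewrite cu mulr0 subr_ge0; apply: IH => // i si.
  have [-> //|ij] := eqVneq i j; apply: ou.
  by rewrite inE negb_or ij.
Qed.

Lemma scalar_bounded_below (U : lmodType R) (m : U -> R) (k : R) :
  scalar m -> (forall x, k <= m x) -> forall x, m x = 0.
Proof.
move=> mlin mk x; apply: contrapT => /eqP mx.
have := mk (((k - 1) / m x) *: x + 0 *: x).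
by rewrite scalar_comb// mul0r addr0 divfK//; lra.
Qed.

(* [x + e (x - y)] extends the segment from [y] to [x] beyond [x]: in finite
   dimension this characterizes the relative interior of a convex set. *)
Definition prolongable (U : lmodType R) (S : U -> Prop) (x : U) : Prop :=
  forall y, S y -> exists2 e, 0 < e & S (x + e *: (x - y)).

(* Fenchel duality in multiplier form: minimize [r + l x] subject to
   [H (A x) r], perturbing the argument of [H]. *)
Lemma fenchel_multiplier (X W : lmodType R) (I : finType) (c : I -> W -> R)
    (A : X -> W) (l : X -> R) (H : W -> R -> Prop) (x0 : X) (r0 : R) :
  (forall i, scalar (c i)) -> linear A -> scalar l -> convex_rel H ->
  H (A x0) r0 -> prolongable (fun w => exists r, H w r) (A x0) ->
  (forall x w r, H w r -> (forall i, c i w = c i (A x)) -> 0 <= r + l x) ->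
  exists y : I -> R,
    (forall w r, H w r -> \sum_i y i * c i w <= r) /\
    forall x, \sum_i y i * c i (A x) + l x = 0.
Proof.
move=> clin Alin llin Hconv H0 Hprol Hpos.
have Acomb a b x z : A (a *: x + b *: z) = a *: A x + b *: A z.
  have A0 : A 0 = 0.
    have := Alin (-1) 0 0; rewrite scaler0 addr0 scaleN1r => E.
    by rewrite {1}E addNr.
  by rewrite Alin -[b *: z]addr0 Alin A0 addr0.
have cB i u v : c i (u - v) = c i u - c i v.
  have -> : u - v = 1 *: u + (-1) *: v by rewrite scale1r scaleN1r.
  by rewrite scalar_comb// mulN1r mul1r.
(* [G u r] says that the cost [r] is reachable once the argument of [H] is perturbed by [u]; [y]
   will be a subgradient at 0 of the value of this perturbed problem. *)
pose G u r := exists x w s, [/\ u = w - A x, H w s & r = s + l x].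
have [|||y Hy] := @dominated_functional W I c G clin.
- move=> _ _ _ _ a b a0 b0 ab [x [w [s [-> Hw ->]]]] [x' [w' [s' [-> Hw' ->]]]].
  exists (a *: x + b *: x'), (a *: w + b *: w'), (a * s + b * s'); split.
  + by rewrite Acomb !scalerBr opprD !addrA; congr (_ + _); rewrite addrAC.
  + exact: Hconv.
  + by rewrite scalar_comb//; ring.
- move=> _ _ [x [w [s [-> Hw _]]]].
  have [|e e0 [t Ht]] := Hprol w; first by exists s.
  (* Both [w] and [x] are reflected with the same ratio [e], through [A x0] and [x0], so their
     difference [w - A x] is multiplied by [- e]. *)
  exists e => //; exists (t + l ((1 + e) *: x0 - e *: x)).
  exists ((1 + e) *: x0 - e *: x), (A x0 + e *: (A x0 - w)), t; split=> //.
  have -> : A ((1 + e) *: x0 - e *: x) = A x0 + e *: (A x0 - A x).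
    by rewrite -scaleNr Acomb scalerDl scale1r scalerBr scaleNr addrA.
  rewrite opprD addrACA subrr add0r scaleNr -scalerBr -scalerN !opprB.
  by congr (_ *: _); rewrite [RHS]addrC addrA subrK.
- move=> _ _ [x [w [s [-> Hw ->]]]] cw; apply: Hpos Hw _ => i.
  by apply/eqP; rewrite -subr_eq0 -cB cw.
exists y.
pose m x := \sum_i y i * c i (A x) + l x.
pose q w := \sum_i y i * c i w.
have qlin : scalar q by apply: scalar_sum.
have mlin : scalar m.
  by move=> a x z; rewrite /m -!/(q _) Alin qlin llin; ring.
have Hm w r x : H w r -> q w - m x <= r.
  move=> Hw; have : G (w - A x) (r + l x) by exists x, w, r.
  have -> : w - A x = 1 *: w + (-1) *: A x by rewrite scale1r scaleN1r.
  by move=> /Hy; rewrite -/(q _) scalar_comb// /m -/(q _); lra.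
(* With [w] frozen at [A x0], the linear function [m] is bounded below, hence zero. *)
have m0 : forall x, m x = 0.
  apply: (@scalar_bounded_below _ _ (q (A x0) - r0)) => // x.
  by have := Hm _ _ x H0; lra.
by split=> // w r /Hm => /(_ 0); rewrite m0 subr0.
Qed.
End Separation.

(** * Affine minorants of convex lower semicontinuous functions *)

Section FenchelMoreau.
Set Implicit Arguments.
Unset Strict Implicit.
Local Open Scope ring_scope.
Context {R : realType}.

Lemma econvex_rel (E : lmodType R) (f : E -> \bar R) :
  econvex f -> convex_rel (fun z v => (f z <= v%:E)%E).
Proof.
move=> fconv u v r s a b a0 b0 ab fu fv.
have a01 : 0 <= a <= 1 by lra.
have := fconv (u, r) (v, s) (Itv01 (proj1 (andP a01)) (proj2 (andP a01))).
rewrite !inE /= => /(_ fu fv).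
have -> : b = 1 - a by lra.
exact.
Qed.

(** On the ball of radius [d] semicontinuity gives values above [b]. A point [z] outside it is
    pulled back along the segment to distance [d / 2] from [x], where the value still exceeds [b];
    convexity then bounds [f z] below with slope [2 * (m - b) / d]. *)
Lemma cone_minorant_dom (E : normedModType R) (f : E -> \bar R) x (m b : R) :
  convex_rel (fun z v => (f z <= v%:E)%E) -> lower_semicontinuous f ->
  f x = m%:E -> b < m ->
  exists2 k, 0 <= k & forall z v, (f z <= v%:E)%E -> b - k * `|z - x| <= v.
Proof.
move=> fconv flsc fx bm.
have [|V xV Vf] := flsc x b; first by rewrite fx lte_fin.
have /nbhs_ballP [d /= d0 dV] := xV.
exists (2 * (m - b) / d); first by apply: divr_ge0; lra.
move=> z v fz; have [zx|zx] := ltP `|z - x| d.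
  have : (b%:E < f z)%E by apply/Vf/dV; rewrite -ball_normE /= distrC.
  move=> /lt_le_trans => /(_ _ fz); rewrite lte_fin => bv.
  suff : 0 <= 2 * (m - b) / d * `|z - x| by lra.
  by apply: mulr_ge0 => //; apply: divr_ge0; lra.
pose e := `|z - x|; pose t := d / (2 * e).
have e0 : 0 < e by apply: lt_le_trans zx.
have t0 : 0 < t by apply: divr_gt0; lra.
have t1 : 0 < 1 - t.
  by rewrite subr_gt0 /t ltr_pdivrMr; [rewrite -/e in zx; lra | lra].
have : (b%:E < f ((1 - t) *: x + t *: z)%R)%E.
  apply/Vf/dV; rewrite -ball_normE /=.
  have -> : x - ((1 - t) *: x + t *: z) = t *: (x - z).
    by rewrite scalerBl scale1r opprD opprB addrA addrCA subrr addr0 -scalerBr.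
  rewrite normrZ gtr0_norm// distrC -/e /t.
  have -> : d / (2 * e) * e = d / 2 by field; rewrite ?gt_eqF.
  by lra.
have fxm : (f x <= m%:E)%E by rewrite fx.
have fp := fconv x z m v (1 - t) t t1 t0 (subrK _ _) fxm fz.
move=> /lt_le_trans => /(_ _ fp); rewrite lte_fin => bv.
have E1 : 2 * (m - b) / d * e * t = m - b by rewrite /t; field; rewrite ?gt_eqF.
rewrite -/e; set K := 2 * (m - b) / d * e in E1 *.
rewrite -subr_ge0 -(pmulr_lge0 _ t0).
by nra.
Qed.

(** Here [x] may lie outside the domain, so the cone is first built at a point [x1] of the domain.
    Away from [x], the constant lost in moving the apex is at most [C], which the extra slope
    [C / d] absorbs. *)
Lemma cone_minorant (E : normedModType R) (f : E -> \bar R) x (b : R) :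
  eproper f -> convex_rel (fun z v => (f z <= v%:E)%E) ->
  lower_semicontinuous f -> (b%:E < f x)%E ->
  exists2 k, 0 <= k & forall z v, (f z <= v%:E)%E -> b - k * `|z - x| <= v.
Proof.
move=> [[x1 fx1] fNy] fconv flsc bx.
have [m fm] : exists m, f x1 = m%:E.
  by move: (fNy x1) fx1; rewrite /edom /=; case: (f x1) => // m _ _; exists m.
have m1 : m - 1 < m by lra.
have [k1 k10 Hk1] := cone_minorant_dom fconv flsc fm m1.
have [V xV Vf] := flsc x b bx.
have /nbhs_ballP [d /= d0 dV] := xV.
pose D := `|x - x1|; pose C := `|b - (m - 1)| + k1 * D.
have D0 : 0 <= D by apply: normr_ge0.
have C0 : 0 <= C by apply: addr_ge0 => //; apply: mulr_ge0.
exists (k1 + C / d); first by apply: addr_ge0 => //; apply: divr_ge0 => //; lra.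
move=> z v fz; have [zx|zx] := ltP `|z - x| d.
  have : (b%:E < f z)%E by apply/Vf/dV; rewrite -ball_normE /= distrC.
  move=> /lt_le_trans => /(_ _ fz); rewrite lte_fin => bv.
  suff : 0 <= (k1 + C / d) * `|z - x| by lra.
  by apply: mulr_ge0 => //; apply: addr_ge0 => //; apply: divr_ge0 => //; lra.
have H := Hk1 _ _ fz.
have tri : `|z - x1| <= `|z - x| + D.
  by apply: le_trans (ler_normD _ _); rewrite addrA subrK.
have E1 : C <= C / d * `|z - x|.
  by rewrite mulrAC ler_pdivlMr// ler_wpM2l.
have := ler_wpM2l k10 tri.
have := ler_norm (b - (m - 1)).
by rewrite mulrDl; move: E1 H; set q := C / d * _; rewrite /C; lra.
Qed.

(* Adding the cone [k |.|] to [f] by infimal convolution makes it finite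
   everywhere, so that the subgradient lemma applies without qualification. *)
Lemma fenchel_moreau (E : normedModType R) (I : finType) (c : I -> E -> R)
    (f : E -> \bar R) x (b : R) :
  (forall i, scalar (c i)) -> (forall u, (forall i, c i u = 0) -> u = 0) ->
  eproper f -> econvex f -> lower_semicontinuous f -> (b%:E < f x)%E ->
  exists y : I -> R, forall z v, (f z <= v%:E)%E ->
    \sum_i y i * c i (z - x) <= v - b.
Proof.
move=> clin cinj fprop /econvex_rel fconv flsc bx.
have [k k0 Hk] := cone_minorant fprop fconv flsc bx.
(* Shifting by [x] and by [b] turns the cone minorant into nonnegativity of [G] at 0. *)
pose G (u : E) r := exists z v,
  (f z <= v%:E)%E /\ v + k * `|z - x - u| <= r + b.
have [|||y Hy] := @dominated_functional R E I c G clin.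
- move=> u u' r r' p q p0 q0 pq [z [v [fz zr]]] [z' [v' [fz' zr']]].
  exists (p *: z + q *: z'), (p * v + q * v'); split; first exact: fconv.
  have -> : p *: z + q *: z' - x - (p *: u + q *: u') =
      p *: (z - x - u) + q *: (z' - x - u').
    have {1}-> : x = p *: x + q *: x by rewrite -scalerDl pq scale1r.
    by rewrite !scalerBr !opprD [p *: z + _ + _]addrACA [LHS]addrACA.
  have N : `|p *: (z - x - u) + q *: (z' - x - u')| <=
      p * `|z - x - u| + q * `|z' - x - u'|.
    apply: le_trans (ler_normD _ _) _.
    by rewrite !normrZ !gtr0_norm.
  have := ler_wpM2l k0 N; have := ler_wpM2l (ltW p0) zr.
  have := ler_wpM2l (ltW q0) zr'.
  set X := `|z - _ - _|; set X' := `|z' - _ - _|; set Y := `|_ + _|.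
  have : p * b + q * b = b by rewrite -mulrDl pq mul1r.
  by rewrite !mulrDr; lra.
- move=> u r _; exists 1 => //.
  have [[x1 fx1] fNy] := fprop.
  have [m fm] : exists m, f x1 = m%:E.
    by move: (fNy x1) fx1; rewrite /edom /=; case: (f x1) => // m _ _; exists m.
  exists (m + k * `|x1 - x - (-1 *: u)| - b), x1, m.
  rewrite fm lexx; split=> //.
  by rewrite subrK.
- move=> u r [z [v [fz zr]]] /cinj u0.
  by have := Hk _ _ fz; move: zr; rewrite u0 subr0; lra.
exists y => z v fz; apply: Hy; exists z, v; split=> //.
by rewrite subrr normr0 mulr0 addr0 subrK.
Qed.
End FenchelMoreau.

(** * Prolongation of segments and relative interiors *)

Section Prolongation.
Set Implicit Arguments.
Unset Strict Implicit.
Local Open Scope ring_scope.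
Context {R : realType}.

(** The prolonged point is on the line through [x] and [y], hence in the affine hull, and [e] is
    small enough to keep it in the relative ball. The added 1 covers the case [y = x]. *)
Lemma relint_prolongable (E : normedModType R) (S : set E) x :
  relint S x -> prolongable S x.
Proof.
move=> [Sx /nbhs_ballP[d /= d0 dS]] y Sy.
have N0 : 0 < 2 * (`|x - y| + 1) by have := normr_ge0 (x - y); lra.
pose e := d / (2 * (`|x - y| + 1)).
have e0 : 0 < e by apply: divr_gt0.
exists e => //; apply: dS.
  rewrite -ball_normE /= opprD addrA subrr add0r normrN normrZ gtr0_norm//.
  by rewrite /e mulrAC ltr_pdivrMr// ltr_pM2l//; have := normr_ge0 (x - y); lra.
move=> A [affA SA].
have -> : x + e *: (x - y) = (1 - - e) *: x + (- e) *: y.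
  by rewrite opprK scalerDl scale1r scaleNr scalerBr addrA.
by apply: affA; apply: SA.
Qed.

Definition convex_pred (U : lmodType R) (S : U -> Prop) : Prop :=
  forall u v (a b : R), 0 < a -> 0 < b -> a + b = 1 ->
    S u -> S v -> S (a *: u + b *: v).

(** The nearer point is a convex combination of [x] and the farther one. This allows one common step
    for finitely many prolongations. *)
Lemma prolongation_shrink (U : lmodType R) (S : U -> Prop) x y (e e' : R) :
  convex_pred S -> S x -> 0 < e' <= e -> S (x + e *: (x - y)) ->
  S (x + e' *: (x - y)).
Proof.
move=> Sconv Sx /andP[e0]; rewrite le_eqVlt => /predU1P[->//|ee] Se.
have e1 : 0 < e by lra.
have -> : x + e' *: (x - y) =
    (1 - e' / e) *: x + (e' / e) *: (x + e *: (x - y)).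
  rewrite [in RHS]scalerDr scalerA divfK ?gt_eqF// addrA -scalerDl subrK.
  by rewrite scale1r.
apply: Sconv => //; last by rewrite subrK.
  by rewrite subr_gt0 ltr_pdivrMr// mul1r.
by apply: divr_gt0.
Qed.

(* The nontrivial half of: (p, w) is in the relative interior of a convex S
   iff p is in that of the projection and w in that of the fibre over p. *)
Lemma prolongable_fiber m n (S : 'rV[R]_m * 'rV[R]_n -> Prop) p w :
  convex_pred S -> prolongable (fun p => exists w, S (p, w)) p ->
  prolongable (fun w => S (p, w)) w -> prolongable S (p, w).
Proof.
move=> Sconv Hp Hw [q v] Sqv.
have [|d d0 [v' Sv']] := Hp q; first by exists v.
have d1 : 0 < 1 + d by lra.
(* [(p, w0)] is where the segment from [(q, v)] to the prolonged point [(p + d *: (p - q), v')]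
   meets the fibre over [p]. *)
pose w0 := (d / (1 + d)) *: v + (1 + d)^-1 *: v'.
have Sw0 : S (p, w0).
  have -> : (p, w0) = (d / (1 + d)) *: (q, v) +
      (1 + d)^-1 *: (p + d *: (p - q), v').
    congr (_, _); apply/rowP => i; rewrite !mxE.
    by field; rewrite gt_eqF.
  apply: Sconv => //; [exact: divr_gt0|by rewrite invr_gt0|].
  by field; rewrite gt_eqF.
have [e e0 Se] := Hw _ Sw0.
have s0 : 0 < e + 1 + d by lra.
(* This step comes from weighting the two prolonged points so that [v'] cancels. *)
exists (e * d / (e + 1 + d)).
  by apply: divr_gt0 => //; apply: mulr_gt0.
have -> : (p, w) + (e * d / (e + 1 + d)) *: ((p, w) - (q, v)) =
    (e / (e + 1 + d)) *: (p + d *: (p - q), v') +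
    ((1 + d) / (e + 1 + d)) *: (p, w + e *: (w - w0)).
  congr (_, _); apply/rowP => i; rewrite !mxE; field;
    by rewrite ?gt_eqF.
apply: Sconv => //; [exact: divr_gt0|exact: divr_gt0|].
by field; rewrite gt_eqF.
Qed.

End Prolongation.

(** * Conjugates, biconjugation and the dot product *)

Section Conjugation.
Set Implicit Arguments.
Unset Strict Implicit.
Context {R : realType}.

(** Real upper bounds [v] of [f z] encode every case: a value +oo gives no constraint, and a value
    -oo makes both sides false. *)
Lemma ereal_sup_subP (Z : Type) (h : Z -> R) (f : Z -> \bar R) (k : R) :
  ereal_sup (range (fun z => (h z)%:E - f z)) <= k%:E <->
  forall z v, f z <= v%:E -> (h z - v <= k)%R.
Proof.
split=> [supk z v fv|H].
  have : (h z)%:E - f z <= k%:E.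
    by apply: le_trans supk; apply: ereal_sup_ubound; exists z.
  by move: fv; case: (f z) => [r| |] //; rewrite -EFinB !lee_fin; lra.
apply: ge_ereal_sup => _ [z _ <-].
have := H z; case: (f z) => [r| |] Hz.
- by rewrite -EFinB lee_fin; apply: Hz.
- by rewrite leNye.
- by have := Hz (h z - k - 1)%R (leNye _); rewrite leNgt => /negP[]; lra.
Qed.

Lemma ereal_sup_sub_gtNy (Z : Type) (h : Z -> R) (f : Z -> \bar R) :
  eproper f -> -oo < ereal_sup (range (fun z => (h z)%:E - f z)).
Proof.
move=> [[z fz] fNy]; apply: lt_le_trans (ereal_sup_ubound _); last first.
  by exists z.
move: (fNy z) fz; rewrite /edom /=; case: (f z) => [r| |]//= _ _.
by rewrite ltNyr.
Qed.

(** Properness keeps -oo out of both terms; otherwise the sum +oo - oo would evaluate to -oo and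
    break the inequality. *)
Lemma fenchel_young (Z : Type) (h : Z -> R) (f : Z -> \bar R) z :
  eproper f ->
  (h z)%:E <= f z + ereal_sup (range (fun z => (h z)%:E - f z)).
Proof.
move=> fprop; have := ereal_sup_sub_gtNy h fprop.
have := ereal_sup_subP h f; set s := ereal_sup _.
case: s => [k| |] // H _; last first.
  by case: (f z) (fprop.2 z) => [r| |]// _; rewrite leey.
have /(_ z) := (H k).1 (lexx _).
case: (f z) (fprop.2 z) => [r| |]// _ Hr; last by rewrite leey.
by rewrite -EFinD lee_fin; have := Hr r (lexx _); lra.
Qed.

Lemma dot_scalarl n (v : 'rV[R]_n) : scalar (fun u => dot u v).
Proof.
move=> a u w; rewrite /dot mulr_sumr -big_split /=; apply: eq_bigr => i _.
by rewrite !mxE; ring.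
Qed.

Lemma dotC n (u v : 'rV[R]_n) : dot u v = dot v u.
Proof. by rewrite /dot; apply: eq_bigr => i _; rewrite mulrC. Qed.

Lemma dot_scalarr n (u : 'rV[R]_n) : scalar (dot u).
Proof. by move=> a v w; rewrite !(dotC u) dot_scalarl. Qed.

Lemma dotBl n (u v w : 'rV[R]_n) : dot (u - v)%R w = (dot u w - dot v w)%R.
Proof. by rewrite addrC -scaleN1r dot_scalarl mulN1r addrC. Qed.

Lemma dot0r n (u : 'rV[R]_n) : dot u 0%R = 0%R.
Proof. by rewrite /dot big1// => i _; rewrite mxE mulr0. Qed.

Lemma dotNl n (u v : 'rV[R]_n) : dot (- u)%R v = (- dot u v)%R.
Proof. by rewrite -sub0r dotBl (dotC 0%R) dot0r sub0r. Qed.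

Lemma dotBr n (u v w : 'rV[R]_n) : dot w (u - v)%R = (dot w u - dot w v)%R.
Proof. by rewrite !(dotC w) dotBl. Qed.

Lemma dotNr n (u v : 'rV[R]_n) : dot u (- v)%R = (- dot u v)%R.
Proof. by rewrite !(dotC u) dotNl. Qed.

Lemma dot_eq0 n (u : 'rV[R]_n) : (forall v, dot u v = 0%R) -> u = 0%R.
Proof.
move=> u0; apply/rowP => i; rewrite mxE -(u0 (delta_mx ord0 i)) /dot.
rewrite (bigD1 i)//= big1 => [|j ji]; rewrite !mxE eqxx ?eqxx/=.
  by rewrite mulr1 addr0.
by rewrite (negbTE ji) mulr0.
Qed.

(** This is g <= g** at [x] in approximate form: [q] is the slope of an affine minorant of [g]
    taking the value [a] at [x]. *)
Lemma conjugate_attains n (g : 'rV[R]_n -> \bar R) x (a : R) :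
  eproper g -> econvex g -> lower_semicontinuous g -> a%:E < g x ->
  exists q, conjugate g q <= (dot x q - a)%:E.
Proof.
move=> gprop gconv glsc ax.
have [|| y Hy] :=
  @fenchel_moreau R 'rV[R]_n 'I_n (fun i u => u ord0 i) g x a _ _ gprop gconv
    glsc ax.
- by move=> i b u v; rewrite !mxE.
- by move=> u u0; apply/rowP => i; rewrite u0 mxE.
exists (\row_i y i)%R; apply/ereal_sup_subP => z v /Hy.
have -> : (\sum_i y i * (z - x)%R ord0 i)%R = dot (z - x)%R (\row_i y i)%R.
  by apply: eq_bigr => i _; rewrite [in RHS]mxE [in RHS]mulrC.
by rewrite dotBl; lra.
Qed.

(** The same for L_t <= K_t*. The arguments of K_t are crossed: [w] is the slope in the state and
    [p] the slope in the velocity. *)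
Lemma dual_lagrangian_attains n (L : nat -> 'rV[R]_n * 'rV[R]_n -> \bar R) t z
    (a : R) :
  eproper (L t) -> econvex (L t) -> lower_semicontinuous (L t) ->
  a%:E < L t z ->
  exists p w, dual_lagrangian L t p w <= (dot z.1 w + dot z.2 p - a)%:E.
Proof.
move=> Lprop Lconv Llsc az.
pose c (i : 'I_n + 'I_n) (u : 'rV[R]_n * 'rV[R]_n) :=
  match i with inl i => u.1 ord0 i | inr i => u.2 ord0 i end.
have [|| y Hy] := @fenchel_moreau R _ _ c (L t) z a _ _ Lprop Lconv Llsc az.
- by case=> i b u v; rewrite /c !mxE.
- move=> [u v] uv0; congr (_, _); apply/rowP => i; rewrite mxE.
    exact: (uv0 (inl i)).
  exact: (uv0 (inr i)).
exists (\row_i y (inr i))%R, (\row_i y (inl i))%R.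
apply/(@ereal_sup_subP _ (fun z => dot z.1 _ + dot z.2 _)%R) => z' v /Hy.
rewrite big_sumType /=.
have -> : (\sum_i y (inl i) * (z'.1 - z.1)%R ord0 i)%R =
    dot (z'.1 - z.1)%R (\row_i y (inl i))%R.
  by apply: eq_bigr => i _; rewrite [in RHS]mxE [in RHS]mulrC.
have -> : (\sum_i y (inr i) * (z'.2 - z.2)%R ord0 i)%R =
    dot (z'.2 - z.2)%R (\row_i y (inr i))%R.
  by apply: eq_bigr => i _; rewrite [in RHS]mxE [in RHS]mulrC.
by rewrite !dotBl; lra.
Qed.

Lemma dual_lagrangian_leP n (L : nat -> 'rV[R]_n * 'rV[R]_n -> \bar R) t p w
    (k : R) :
  dual_lagrangian L t p w <= k%:E <->
  forall z v, L t z <= v%:E -> (dot z.1 w + dot z.2 p - v <= k)%R.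
Proof. exact: (ereal_sup_subP (fun z => dot z.1 w + dot z.2 p)%R). Qed.

Lemma dual_lagrangian_conv n (L : nat -> 'rV[R]_n * 'rV[R]_n -> \bar R) t
    p w p' w' (k k' a b : R) :
  (0 < a)%R -> (0 < b)%R -> (a + b = 1)%R ->
  dual_lagrangian L t p w <= k%:E -> dual_lagrangian L t p' w' <= k'%:E ->
  dual_lagrangian L t (a *: p + b *: p')%R (a *: w + b *: w')%R <=
    (a * k + b * k')%:E.
Proof.
move=> a0 b0 ab /dual_lagrangian_leP H /dual_lagrangian_leP H'.
apply/dual_lagrangian_leP => z v Lz.
rewrite !(scalar_comb _ _ _ _ (@dot_scalarr _ _)).
have := ler_wpM2l (ltW a0) (H _ _ Lz).
have := ler_wpM2l (ltW b0) (H' _ _ Lz).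
have : (a * v + b * v = v)%R by rewrite -mulrDl ab mul1r.
by rewrite !mulrBr !mulrDr; lra.
Qed.

Lemma conjugate_conv n (g : 'rV[R]_n -> \bar R) p p' (k k' a b : R) :
  (0 < a)%R -> (0 < b)%R -> (a + b = 1)%R ->
  conjugate g p <= k%:E -> conjugate g p' <= k'%:E ->
  conjugate g (a *: p + b *: p')%R <= (a * k + b * k')%:E.
Proof.
move=> a0 b0 ab /ereal_sup_subP H /ereal_sup_subP H'.
apply/ereal_sup_subP => z v gz.
rewrite (scalar_comb _ _ _ _ (@dot_scalarr _ _)).
have := ler_wpM2l (ltW a0) (H _ _ gz).
have := ler_wpM2l (ltW b0) (H' _ _ gz).
have : (a * v + b * v = v)%R by rewrite -mulrDl ab mul1r.
by rewrite !mulrBr; lra.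
Qed.

End Conjugation.

(** * Domain of the dual Lagrangian and weak duality *)

Section Duality.
Set Implicit Arguments.
Unset Strict Implicit.
Context {R : realType} (n T : nat).
Local Notation V := 'rV[R]_n.
Variables (L : nat -> V * V -> \bar R) (g : V -> \bar R).

Lemma ltyP (x : \bar R) : x < +oo <-> exists k, x <= k%:E.
Proof.
split=> [|[k]]; last by move=> /le_lt_trans; apply; rewrite ltry.
by case: x => [r| |]// _; [exists r|exists 0%R; rewrite leNye].
Qed.

(** The linear change of variables from [(p, w)] to [(p + w, w)] carries the graph of [GammaK L t],
    with projection [PK L t], onto the domain of K_t, so the fibre criterion applies. Properness of
    [L t] excludes the value -oo, so finiteness is just an upper bound. *)
Lemma dual_lagrangian_prolongable t p w :
  eproper (L t) -> relint (PK L t) p -> relint (GammaK L t p) w ->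
  prolongable (fun z => exists k, dual_lagrangian L t z.1 z.2 <= k%:E)
    ((p + w)%R, w).
Proof.
move=> Lprop /relint_prolongable Hp /relint_prolongable Hw.
pose S (z : V * V) := GammaK L t z.1 z.2.
have SE z : S z <-> exists k, dual_lagrangian L t (z.1 + z.2)%R z.2 <= k%:E.
  apply: iff_trans (ltyP _).
  by rewrite /S /GammaK /= fin_numElt ereal_sup_sub_gtNy.
have Sconv : convex_pred S.
  move=> u v a b a0 b0 ab /SE[k Hk] /SE[k' Hk']; apply/SE.
  exists (a * k + b * k')%R.
  have -> : ((a *: u + b *: v).1 + (a *: u + b *: v).2 =
      a *: (u.1 + u.2) + b *: (v.1 + v.2))%R.
    by rewrite /= !scalerDr addrACA.
  exact: dual_lagrangian_conv.
move=> [q v] /= Hqv.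
have [|e e0 /SE[k /= Hk]] :=
    @prolongable_fiber R n n S p w Sconv Hp Hw (q - v, v)%R.
  by apply/SE; rewrite /= subrK.
exists e => //; exists k => /=.
have -> // : (p + w + e *: (p + w - q) =
    p + e *: (p - (q - v)) + (w + e *: (w - v)))%R.
by apply/rowP => i; rewrite !mxE; ring.
Qed.

Lemma dual_terminal_conv p p' (k k' a b : R) :
  (0 < a)%R -> (0 < b)%R -> (a + b = 1)%R ->
  dual_terminal g p <= k%:E -> dual_terminal g p' <= k'%:E ->
  dual_terminal g (a *: p + b *: p')%R <= (a * k + b * k')%:E.
Proof.
move=> a0 b0 ab Hk Hk'.
by rewrite /dual_terminal opprD -!scalerN; apply: conjugate_conv.
Qed.

(** At [tau = T] the sum is empty and the constraint fixes the terminal point, so the infimum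
    formula covers this case too. *)
Lemma dual_valueE tau eta : (tau <= T)%N -> dual_value T L g tau eta =
  ereal_inf [set dual_cost T L g tau p | p in [set p | p tau = (- eta)%R]].
Proof.
rewrite leq_eqVlt /dual_value => /predU1P[->|->//]; rewrite ltnn.
rewrite (_ : [set _ | _ in _] = [set dual_terminal g (- eta)%R]) ?ereal_inf1//.
apply/seteqP; split=> [_ [p /= pT <-]|_ ->].
  by rewrite /dual_cost big_geq// add0e pT.
by exists (fun=> (- eta)%R) => //=; rewrite /dual_cost big_geq// add0e.
Qed.

Lemma primal_valueE tau xi : (tau <= T)%N -> primal_value T L g tau xi =
  ereal_inf [set primal_cost T L g tau x | x in [set x | x tau = xi]].
Proof.
rewrite leq_eqVlt /primal_value => /predU1P[->|->//]; rewrite ltnn.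
rewrite (_ : [set _ | _ in _] = [set g xi]) ?ereal_inf1//.
apply/seteqP; split=> [_ [x /= xT <-]|_ ->].
  by rewrite /primal_cost big_geq// add0e xT.
by exists (fun=> xi) => //=; rewrite /primal_cost big_geq// add0e.
Qed.

(** Discrete product rule, the source of the summations by parts. *)
Lemma dot_delta (x p : nat -> V) t :
  (dot (x t.-1) (delta p t) + dot (delta x t) (p t) =
   dot (x t) (p t) - dot (x t.-1) (p t.-1))%R.
Proof. by rewrite /delta dotBl dotBr; ring. Qed.

Lemma sum_delta (V' : zmodType) (F : nat -> V') tau : (tau <= T)%N ->
  (\sum_(tau.+1 <= t < T.+1) (F t - F t.-1) = F T - F tau)%R.
Proof. by move=> tT; rewrite big_add1/= telescope_sumr. Qed.

(** The running terms telescope to the pairings at [T] and [tau]; the terminal inequality cancels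
    the one at [T]. *)
Lemma weak_duality tau x p : (tau <= T)%N ->
  (forall t, (1 <= t <= T)%N -> eproper (L t)) -> eproper g ->
  (dot (x tau) (- p tau)%R)%:E <=
    primal_cost T L g tau x + dual_cost T L g tau p.
Proof.
move=> tT Lprop gprop; rewrite /primal_cost /dual_cost addeACA -big_split /=.
have step t : (tau < t <= T)%N ->
    (dot (x t) (p t) - dot (x t.-1) (p t.-1))%:E <=
    L t (x t.-1, delta x t) + dual_lagrangian L t (p t) (delta p t).
  move=> tauT; rewrite -dot_delta.
  apply: (fenchel_young (fun z => dot z.1 (delta p t) + dot z.2 (p t))%R).
  by apply: Lprop; lia.
have last : (dot (x T) (- p T)%R)%:E <= g (x T) + dual_terminal g (p T).
  exact: (fenchel_young (fun z => dot z (- p T)%R)).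
have sum_le : \sum_(tau.+1 <= t < T.+1)
      (dot (x t) (p t) - dot (x t.-1) (p t.-1))%:E <=
    \sum_(tau.+1 <= t < T.+1)
      (L t (x t.-1, delta x t) + dual_lagrangian L t (p t) (delta p t)).
  rewrite big_nat_cond [leRHS]big_nat_cond; apply: lee_sum => t tauT.
  by apply: step; move: tauT; rewrite andbT ltnS.
apply: le_trans (leeD sum_le last).
rewrite sumEFin -EFinD lee_fin (sum_delta (fun t => dot (x t) (p t)))//.
by rewrite !dotNr; lra.
Qed.

End Duality.

(** * Splitting of strict bounds, and coordinates on paths *)

Section StrongDuality.
Set Implicit Arguments.
Unset Strict Implicit.
Context {R : realType} (n T : nat).
Local Notation V := 'rV[R]_n.
Local Notation W := ((nat -> V) * (nat -> V) * V)%type.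

Lemma lt_adde_split (mu : R) (x y : \bar R) : -oo < x -> -oo < y ->
  mu%:E < x + y -> exists a b, [/\ a%:E < x, b%:E < y & (mu < a + b)%R].
Proof.
case: x => [r| |]// _; case: y => [s| |]// _ H.
- move: H; rewrite -EFinD lte_fin => H.
  (* Each term gives up a third of the slack, and the last third keeps the sum above [mu]. *)
  exists (r - (r + s - mu) / 3)%R, (s - (r + s - mu) / 3)%R.
  by rewrite !lte_fin; split; lra.
- by exists (r - 1)%R, (mu - r + 2)%R; rewrite lte_fin ltry; split=> //; lra.
- by exists (mu - s + 2)%R, (s - 1)%R; rewrite lte_fin ltry; split=> //; lra.
- by exists (mu + 1)%R, 0%R; rewrite !ltry; split=> //; lra.
Qed.

(** Affine minorants exist only strictly below a function value, so a strict bound on a total cost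
    has to be distributed over its terms. *)
Lemma lt_sume_split (mu : R) (s : seq nat) (F : nat -> \bar R) : uniq s ->
  (forall t, t \in s -> -oo < F t) -> mu%:E < \sum_(t <- s) F t ->
  exists a : nat -> R, (forall t, t \in s -> (a t)%:E < F t) /\
    (mu < \sum_(t <- s) a t)%R.
Proof.
elim: s mu => [|h s IH] mu /=.
  move=> _ _; rewrite big_nil lte_fin => mu0; exists (fun=> 0%R).
  by rewrite big_nil.
move=> /andP[hs us] FNy; rewrite big_cons => muF.
have FsNy t : t \in s -> -oo < F t.
  by move=> ts; apply: FNy; rewrite inE ts orbT.
have sNy : -oo < \sum_(t <- s) F t.
  rewrite ltNye; apply/negP => /eqP/esum_eqNyP[t [ts _ Ft]].
  by have := FsNy t ts; rewrite Ft.
have [|a [b [ah bs muab]]] := lt_adde_split _ sNy muF.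
  by apply: FNy; rewrite inE eqxx.
have [a' [a'F ba']] := IH _ us FsNy bs.
have ne t : t \in s -> (t == h) = false.
  by move=> ts; apply/negP => /eqP th; rewrite -th ts in hs.
exists (fun t => if t == h then a else a' t); split.
  move=> t; rewrite inE; have [->//|_ /=] := eqVneq t h; exact: a'F.
rewrite big_cons eqxx (eq_big_seq a'); last by move=> t /ne ->.
by lra.
Qed.

(** The minimum of finitely many thresholds works because each property persists for smaller
    steps. *)
Lemma common_prolongation (m : nat) (P : nat -> R -> Prop) :
  (forall t, (t < m)%N ->
    exists2 e, (0 < e)%R & forall e', (0 < e' <= e)%R -> P t e') ->
  exists2 e, (0 < e)%R & forall t e', (t < m)%N -> (0 < e' <= e)%R -> P t e'.
Proof.
elim: m => [_|m IH H]; first by exists 1%R.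
have [|e e0 He] := IH; first by move=> t tm; apply: H; apply: ltnW.
have [d d0 Hd] := H m (ltnSn m).
exists (Num.min e d); first by rewrite lt_min e0.
move=> t e'; rewrite ltnS leq_eqVlt le_min.
by move=> /predU1P[->|tm] /and3P[? ? ?]; [apply: Hd|apply: He => //];
  apply/andP.
Qed.

(** Paths are infinite sequences, but only the times in [tau < t <= T] matter, so finitely many
    coordinates suffice. They do not separate points of [W], which is why [fenchel_multiplier]
    compares points only through coordinates. *)
Definition path_coord (tau : nat)
    (i : ('I_T.+1 * 'I_n) + ('I_T.+1 * 'I_n) + 'I_n) (w : W) : R :=
  match i with
  | inl (inl tj) => if (tau < tj.1)%N then w.1.1 tj.1 ord0 tj.2 else 0%R
  | inl (inr tj) => if (tau < tj.1)%N then w.1.2 tj.1 ord0 tj.2 else 0%R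
  | inr j => w.2 ord0 j
  end.

Lemma path_coord_scalar tau i : scalar (path_coord tau i).
Proof.
move=> a u v; case: i => [[[t j]|[t j]]|j] /=; rewrite ?mxE //;
  by case: ifP => _; rewrite ?mxE // mulr0 addr0.
Qed.

Lemma sum_pair_dot tau (y : 'I_T.+1 * 'I_n -> R) (u : nat -> V) :
  (\sum_i y i * (if (tau < i.1)%N then u i.1 ord0 i.2 else 0) =
   \sum_(tau.+1 <= t < T.+1) dot (\row_j y (inord t, j)) (u t))%R.
Proof.
rewrite big_geq_mkord [RHS]big_mkcond /=.
transitivity (\sum_(i : 'I_T.+1 * 'I_n)
    (fun t j => y (t, j) * (if (tau < t)%N then u t ord0 j else 0)) i.1 i.2)%R.
  by apply: eq_bigr => -[t j].
rewrite -(pair_bigA _ (fun t j => y (t, j) *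
  (if (tau < t)%N then u t ord0 j else 0)))%R /=.
apply: eq_bigr => t _; case: ifP => tt; last first.
  by rewrite big1// => j _; rewrite mulr0.
by apply: eq_bigr => j _; rewrite mxE inord_val.
Qed.

Lemma path_coord_pairing tau y : exists (ya yb : nat -> V) (yc : V), forall w,
  (\sum_i y i * path_coord tau i w =
   \sum_(tau.+1 <= t < T.+1) (dot (ya t) (w.1.1 t) + dot (yb t) (w.1.2 t))
   + dot yc w.2)%R.
Proof.
exists (fun t => \row_j y (inl (inl (inord t, j))))%R.
exists (fun t => \row_j y (inl (inr (inord t, j))))%R.
exists (\row_j y (inr j))%R => w.
rewrite !big_sumType /= big_split /=; congr (_ + _ + _)%R.
- exact: (sum_pair_dot tau (fun i => y (inl (inl i)))).
- exact: (sum_pair_dot tau (fun i => y (inl (inr i)))).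
- by apply: eq_bigr => j _; rewrite mxE.
Qed.

(* Vanishing of the pairing on all trajectories [p] says, by summation by
   parts, that the multipliers are the primal trajectory [x] with
   [ya t = x (t - 1)], [yb t = x t - x (t - 1)] and [yc = - x T]. *)
Lemma multiplier_trajectory tau xi (ya yb : nat -> V) (yc : V) :
  (tau <= T)%N ->
  (forall p : nat -> V,
    \sum_(tau.+1 <= t < T.+1) (dot (ya t) (delta p t) + dot (yb t) (p t))
    + dot yc (p T) + dot xi (p tau) = 0)%R ->
  exists x : nat -> V, [/\ x tau = xi, yc = (- x T)%R &
    forall t, (tau < t <= T)%N -> ya t = x t.-1 /\ yb t = delta x t].
Proof.
move=> tauT yp0.
pose x t := if (t < T)%N then ya t.+1 else (- yc)%R.
have xT : yc = (- x T)%R by rewrite /x ltnn opprK.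
have xa t : (tau < t <= T)%N -> ya t = x t.-1.
  by case: t => // t /= /andP[_ tT]; rewrite /x tT.
(* Summation by parts removes [delta p], so the values [p t] can now be varied independently, one
   time after another. *)
have xp0 p : (\sum_(tau.+1 <= t < T.+1) dot (yb t - delta x t) (p t)
    + dot (xi - x tau) (p tau) = 0)%R.
  rewrite -[RHS](yp0 p) xT.
  rewrite (eq_big_nat _ _ (F2 := fun t => (dot (ya t) (delta p t) +
    dot (yb t) (p t)) - (dot (x t) (p t) - dot (x t.-1) (p t.-1)))%R);
    last first.
    by move=> t tT; rewrite -dot_delta xa// dotBl; ring.
  rewrite sumrB (sum_delta (fun t => dot (x t) (p t)))// dotBl dotNl.
  by ring.
exists x; split=> //.
  apply/esym/eqP; rewrite -subr_eq0; apply/eqP/dot_eq0 => v.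
  have := xp0 (fun t => if t == tau then v else 0)%R; rewrite eqxx.
  rewrite big_nat_cond big1 ?add0r// => t /andP[/andP[tt _] _].
  by rewrite gtn_eqF// dot0r.
move=> t tT; split; first exact: xa.
apply/eqP; rewrite -subr_eq0; apply/eqP/dot_eq0 => v.
have := xp0 (fun s => if s == t then v else 0)%R.
rewrite ltn_eqF ?dot0r ?addr0; last by case/andP: tT.
rewrite (bigD1_seq t) ?iota_uniq ?mem_index_iota//= eqxx big1 ?addr0//.
by move=> s /negbTE ->; rewrite dot0r.
Qed.

End StrongDuality.

(** * Multipliers of the dual problem and strong duality *)

Section Bolza.
Set Implicit Arguments.
Unset Strict Implicit.
Context {R : realType} (n T : nat).
Local Notation V := 'rV[R]_n.
Local Notation W := ((nat -> V) * (nat -> V) * V)%type.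
Variables (L : nat -> V * V -> \bar R) (g : V -> \bar R).

(** In the conclusion [a], [b] and [q] are no longer tied to one trajectory: the multipliers pay for
    the constraints [a = delta b] and [q = b T]. The separate suprema over them are therefore
    conjugates of K_t and f. *)
Lemma bolza_multipliers tau xi (mu : R) (pbar : nat -> V) (kbar : nat -> R)
    (kfbar : R) :
  (tau <= T)%N ->
  (forall t, (tau < t <= T)%N ->
    dual_lagrangian L t (pbar t) (delta pbar t) <= (kbar t)%:E) ->
  dual_terminal g (pbar T) <= kfbar%:E ->
  (forall t, (tau < t <= T)%N ->
    prolongable (fun z => exists k, dual_lagrangian L t z.1 z.2 <= k%:E)
      (pbar t, delta pbar t)) ->
  prolongable (fun q => exists k, dual_terminal g q <= k%:E) (pbar T) ->
  (forall (p : nat -> V) (k : nat -> R) (kf : R),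
    (forall t, (tau < t <= T)%N ->
      dual_lagrangian L t (p t) (delta p t) <= (k t)%:E) ->
    dual_terminal g (p T) <= kf%:E ->
    (0 <= \sum_(tau.+1 <= t < T.+1) k t + kf + mu + dot xi (p tau))%R) ->
  exists x : nat -> V, x tau = xi /\
    forall (a b : nat -> V) (q : V) (k : nat -> R) (kf : R),
      (forall t, (tau < t <= T)%N ->
        dual_lagrangian L t (b t) (a t) <= (k t)%:E) ->
      dual_terminal g q <= kf%:E ->
      (\sum_(tau.+1 <= t < T.+1)
        (dot (x t.-1) (a t) + dot (delta x t) (b t) - k t)
       - dot (x T) q - kf <= mu)%R.
Proof.
move=> tauT Kbar fbar Kprol fprol bound.
(* Including [mu] in the cost turns the lower bound [- mu] into the sign condition of the multiplier
   lemma. *)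
pose H (w : W) (s : R) := exists (k : nat -> R) (kf : R),
  [/\ forall t, (tau < t <= T)%N ->
        dual_lagrangian L t (w.1.2 t) (w.1.1 t) <= (k t)%:E,
      dual_terminal g w.2 <= kf%:E &
      s = (\sum_(tau.+1 <= t < T.+1) k t + kf + mu)%R].
pose A (p : nat -> V) : W := (delta p, p, p T).
pose l (p : nat -> V) := dot xi (p tau).
have Alin : linear A.
  move=> a u v; congr (_, _, _); apply/funext => t.
  rewrite -[RHS]/(a *: delta u t + delta v t)%R.
  rewrite -[LHS]/(a *: u t + v t - (a *: u t.-1 + v t.-1))%R.
  by rewrite /delta scalerBr opprD addrACA.
have llin : scalar l by move=> a u v; rewrite /l dot_scalarr.
have Hconv : convex_rel H.
  move=> u v r s a b a0 b0 ab [k [kf [Hk Hf ->]]] [k' [kf' [Hk' Hf' ->]]].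
  exists (fun t => a * k t + b * k' t)%R, (a * kf + b * kf')%R; split.
  - by move=> t tT; apply: dual_lagrangian_conv => //; [apply: Hk|apply: Hk'].
  - exact: dual_terminal_conv.
  - rewrite big_split /= -!mulr_sumr.
    have : (a * mu + b * mu = mu)%R by rewrite -mulrDl ab mul1r.
    by rewrite !mulrDr; lra.
have Hprol : prolongable (fun w => exists r, H w r) (A pbar).
  move=> w [r [k [kf [Hk Hf _]]]].
  pose P t e := (tau < t <= T)%N -> exists k',
    dual_lagrangian L t (pbar t + e *: (pbar t - w.1.2 t))%R
      (delta pbar t + e *: (delta pbar t - w.1.1 t))%R <= k'%:E.
  have [t _|e e0 He] := @common_prolongation R T.+1 P.
    have [tT|tT] := boolP (tau < t <= T)%N; last first.
      by exists 1%R => // e' _ tT'; rewrite tT' in tT.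
    have [|e e0 [k' Hk']] := Kprol t tT (w.1.2 t, w.1.1 t).
      by exists (k t); apply: Hk.
    exists e => // e' ee' _.
    pose S (z : V * V) := exists k, dual_lagrangian L t z.1 z.2 <= k%:E.
    apply: (@prolongation_shrink _ _ S (pbar t, delta pbar t)
      (w.1.2 t, w.1.1 t) e e') => //.
    - move=> u v a b a0 b0 ab [k1 H1] [k2 H2]; exists (a * k1 + b * k2)%R.
      exact: dual_lagrangian_conv.
    - by exists (kbar t); apply: Kbar.
    - by exists k'.
  have [|d d0 Hd] := fprol w.2; first by exists kf.
  (* One step must serve all the times and the terminal point. *)
  pose m := Num.min e d.
  have m0 : (0 < m)%R by rewrite lt_min e0.
  exists m => //.
  have /choice[k' Hk'] : forall t, exists k', (tau < t <= T)%N ->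
    dual_lagrangian L t (pbar t + m *: (pbar t - w.1.2 t))%R
      (delta pbar t + m *: (delta pbar t - w.1.1 t))%R <= k'%:E.
    move=> t; have [tT|tT] := boolP (tau < t <= T)%N; last by exists 0%R.
    have [||k' Hk'] := He t m _ _ tT; last by exists k'.
      by case/andP: tT.
    by rewrite m0 ge_min lexx.
  have [kf' Hf'] : exists kf', dual_terminal g (pbar T + m *: (pbar T - w.2))%R
      <= kf'%:E.
    pose S q := exists k, dual_terminal g q <= k%:E.
    apply: (@prolongation_shrink _ _ S (pbar T) w.2 d m) => //.
    - move=> u v a b a0 b0 ab [k1 H1] [k2 H2]; exists (a * k1 + b * k2)%R.
      exact: dual_terminal_conv.
    - by exists kfbar.
    - by rewrite m0 ge_min lexx orbT.
  by exists (\sum_(tau.+1 <= t < T.+1) k' t + kf' + mu)%R, k', kf'.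
have Hbar : H (A pbar) (\sum_(tau.+1 <= t < T.+1) kbar t + kfbar + mu)%R.
  by exists kbar, kfbar.
have [|y [y1 y2]] := fenchel_multiplier (@path_coord_scalar R n T tau)
    Alin llin Hconv Hbar Hprol.
  move=> p w r [k [kf [Hk Hf ->]]] cw; apply: bound.
    move=> t tT.
    have tT1 : (t < T.+1)%N by case/andP: tT.
    have [tt _] := andP tT.
    have <- : w.1.2 t = p t.
      apply/rowP => j; have := cw (inl (inr (Ordinal tT1, j))).
      by rewrite /= tt.
    have <- : w.1.1 t = delta p t.
      apply/rowP => j; have := cw (inl (inl (Ordinal tT1, j))).
      by rewrite /= tt.
    exact: Hk.
  have <- : w.2 = p T by apply/rowP => j; have := cw (inr j).
  exact: Hf.
have [ya [yb [yc yE]]] := path_coord_pairing tau y.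
have [|x [xtau ycE yx]] := @multiplier_trajectory R n T tau xi ya yb yc tauT.
  by move=> p; have := y2 p; rewrite yE.
exists x; split=> // a b q k kf Hk Hf.
have := y1 (a, b, q) (\sum_(tau.+1 <= t < T.+1) k t + kf + mu)%R.
have Hw : H (a, b, q) (\sum_(tau.+1 <= t < T.+1) k t + kf + mu)%R.
  by exists k, kf.
move=> /(_ Hw); rewrite yE /= ycE dotNl sumrB.
rewrite (eq_big_nat _ _
  (F2 := fun t => dot (x t.-1) (a t) + dot (delta x t) (b t)))%R; last first.
  by move=> t tT; have [-> ->] := yx t tT.
by lra.
Qed.

(** If the multiplier trajectory cost more than [mu], real numbers strictly below its terms would
    still add up to more than [mu]. Affine minorants of [L t] and [g] through these numbers have
    slopes which, put into the decoupled inequality, bound that same sum by [mu]. *)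
Lemma strong_duality tau xi (mu : R) (pbar : nat -> V) (kbar : nat -> R)
    (kfbar : R) :
  (tau <= T)%N ->
  (forall t, (1 <= t <= T)%N -> eproper (L t)) ->
  (forall t, (1 <= t <= T)%N -> econvex (L t)) ->
  (forall t, (1 <= t <= T)%N -> lower_semicontinuous (L t)) ->
  eproper g -> econvex g -> lower_semicontinuous g ->
  (forall t, (tau < t <= T)%N ->
    dual_lagrangian L t (pbar t) (delta pbar t) <= (kbar t)%:E) ->
  dual_terminal g (pbar T) <= kfbar%:E ->
  (forall t, (tau < t <= T)%N ->
    prolongable (fun z => exists k, dual_lagrangian L t z.1 z.2 <= k%:E)
      (pbar t, delta pbar t)) ->
  prolongable (fun q => exists k, dual_terminal g q <= k%:E) (pbar T) ->
  (forall p : nat -> V,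
    (- dot xi (p tau) - mu)%:E <= dual_cost T L g tau p) ->
  exists x : nat -> V, x tau = xi /\ primal_cost T L g tau x <= mu%:E.
Proof.
move=> tauT Lprop Lconv Llsc gprop gconv glsc Kbar fbar Kprol fprol bound.
have pos t : (tau < t <= T)%N -> (1 <= t <= T)%N.
  by move=> /andP[tt ->]; rewrite (leq_ltn_trans _ tt).
have [|x [xtau xle]] :=
    @bolza_multipliers tau xi mu pbar kbar kfbar tauT Kbar fbar Kprol fprol.
  move=> p k kf Hk Hf.
  have : dual_cost T L g tau p <= (\sum_(tau.+1 <= t < T.+1) k t + kf)%:E.
    rewrite EFinD -sumEFin; apply: leeD => //.
    rewrite big_nat_cond [leRHS]big_nat_cond; apply: lee_sum => t.
    by rewrite andbT => tT; apply: Hk.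
  by move=> /(le_trans (bound p)); rewrite lee_fin; lra.
exists x; split=> //; rewrite leNgt; apply/negP => lt.
have tr t : t \in index_iota tau.+1 T.+1 = (tau < t <= T)%N.
  by rewrite mem_index_iota.
have LNy t : t \in index_iota tau.+1 T.+1 -> -oo < L t (x t.-1, delta x t).
  by rewrite tr => tT; apply: (Lprop t (pos t tT)).2.
have sNy : -oo < \sum_(tau.+1 <= t < T.+1) L t (x t.-1, delta x t).
  rewrite ltNye; apply/negP => /eqP/esum_eqNyP[t [ts _ Ft]].
  by have := LNy t ts; rewrite Ft.
have [c [a' [cs ag ca]]] := lt_adde_split sNy (gprop.2 (x T)) lt.
have [al [alL cal]] := lt_sume_split (iota_uniq _ _) LNy cs.
have /choice[z zK] : forall t, exists z : V * V, (tau < t <= T)%N ->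
    dual_lagrangian L t z.1 z.2 <=
      (dot (x t.-1) z.2 + dot (delta x t) z.1 - al t)%:E.
  move=> t; have [tT|tT] := boolP (tau < t <= T)%N; last by exists (0, 0)%R.
  have alt : (al t)%:E < L t (x t.-1, delta x t) by apply: alL; rewrite tr.
  have [p [w pw]] := dual_lagrangian_attains (Lprop t (pos t tT))
    (Lconv t (pos t tT)) (Llsc t (pos t tT)) alt.
  by exists (p, w).
have [q gq] := conjugate_attains gprop gconv glsc ag.
have fq : dual_terminal g (- q)%R <= (dot (x T) q - a')%:E.
  by rewrite /dual_terminal opprK.
(* With these slopes the summand at time [t] reduces to [al t] and the terminal part to [a']. *)
have := xle (fun t => (z t).2) (fun t => (z t).1) (- q)%R _ _ zK fq.
rewrite (eq_big_nat _ _ (F2 := al)) => [|t _]; last by ring.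
by rewrite dotNr; lra.
Qed.

End Bolza.

(** * The conjugate of the dual value function against primal and dual costs *)

Section ConjugateOfDualValue.
Set Implicit Arguments.
Unset Strict Implicit.
Context {R : realType} (n T : nat).
Local Notation V := 'rV[R]_n.
Variables (L : nat -> V * V -> \bar R) (g : V -> \bar R).

Lemma conjugate_dual_value_le_primal tau xi x : (tau <= T)%N ->
  (forall t, (1 <= t <= T)%N -> eproper (L t)) -> eproper g ->
  x tau = xi ->
  conjugate (dual_value T L g tau) xi <= primal_cost T L g tau x.
Proof.
move=> tauT Lprop gprop xtau; apply: ge_ereal_sup => _ [eta _ <-] /=.
rewrite -xtau.
have wd p : p tau = (- eta)%R -> (dot eta (x tau))%:E <=
    primal_cost T L g tau x + dual_cost T L g tau p.
  move=> pt; have := weak_duality x p tauT Lprop gprop.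
  by rewrite pt opprK dotC.
move: wd; case: (primal_cost _ _ _ _ _) => [r| |] wd; last 2 first.
- by rewrite leey.
(* A primal cost of -oo is refuted by weak duality against a constant path. *)
- by have := wd (fun=> - eta)%R erefl.
have : (dot eta (x tau) - r)%:E <= dual_value T L g tau eta.
  rewrite dual_valueE//; apply: le_ereal_inf_tmp => _ [p /= pt <-].
  have := wd p pt.
  case: (dual_cost _ _ _ _ _) => [d| |] //; last by rewrite !leey.
  by rewrite -EFinD !lee_fin; lra.
case: (dual_value T L g tau eta) => [d| |] //; last by rewrite leNye.
by rewrite -EFinB !lee_fin; lra.
Qed.

(** Testing the conjugate at [eta = - p tau] yields the lower bound on dual costs that strong
    duality requires, with [mu] the value of the conjugate. *)
Lemma le_conjugate_dual_value tau xi p : (tau <= T)%N ->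
  (- dot xi (p tau))%:E - dual_cost T L g tau p <=
    conjugate (dual_value T L g tau) xi.
Proof.
move=> tauT; apply: le_trans (ereal_sup_ubound _); last first.
  by exists (- p tau)%R.
rewrite dotNl (dotC (p tau)); apply: leeB => //; rewrite dual_valueE//.
by apply: ereal_inf_lbound; exists p => //=; rewrite opprK.
Qed.

End ConjugateOfDualValue.

Theorem proposition2p6 (R : realType) (T n : nat)
    (T_ge1 : (1 <= T)%N) (n_ge1 : (1 <= n)%N)
    (L : nat -> 'rV[R]_n * 'rV[R]_n -> \bar R) (g : 'rV[R]_n -> \bar R)
    (L_proper : forall t : nat, (1 <= t <= T)%N -> eproper (L t))
    (L_convex : forall t : nat, (1 <= t <= T)%N -> econvex (L t))
    (L_lsc : forall t : nat, (1 <= t <= T)%N -> lower_semicontinuous (L t))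
    (g_proper : eproper g)
    (g_convex : econvex g)
    (g_lsc : lower_semicontinuous g)
    (qualification : exists pbar : nat -> 'rV[R]_n,
      relint (edom (dual_terminal g)) (pbar T) /\
      forall t : nat, (1 <= t <= T)%N ->
        relint (PK L t) (pbar t.-1) /\
        relint (GammaK L t (pbar t.-1)) (delta pbar t)) :
  forall tau : nat, (tau <= T)%N ->
    conjugate (dual_value T L g tau) = primal_value T L g tau /\
    forall xi : 'rV[R]_n, edom (primal_value T L g tau) xi ->
      exists x : nat -> 'rV[R]_n,
        x tau = xi /\ primal_cost T L g tau x = primal_value T L g tau xi.
Proof.
move=> tau tauT; have [pbar [fbar Kbar]] := qualification.
have pos t : (tau < t <= T)%N -> (1 <= t <= T)%N.
  by move=> /andP[tt ->]; rewrite (leq_ltn_trans _ tt).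
have stepE t : (pbar t.-1 + delta pbar t = pbar t)%R.
  by rewrite /delta addrC subrK.
have /choice[kbar Hk] : forall t, exists k, (tau < t <= T)%N ->
    dual_lagrangian L t (pbar t) (delta pbar t) <= k%:E.
  move=> t; have [tT|tT] := boolP (tau < t <= T)%N; last by exists 0%R.
  have [_ [+ _]] := Kbar t (pos t tT).
  rewrite /GammaK /= stepE => /fin_numPlt/andP[_ /ltyP[k Kk]].
  by exists k.
have [kf Hkf] := (ltyP _).1 fbar.1.
have Kprol t : (tau < t <= T)%N ->
    prolongable (fun z => exists k, dual_lagrangian L t z.1 z.2 <= k%:E)
      (pbar t, delta pbar t).
  move=> tT; have [Hp Hw] := Kbar t (pos t tT).
  by rewrite -[in (pbar t, _)]stepE; apply: dual_lagrangian_prolongable => //;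
    apply: L_proper; apply: pos.
have fprol :
    prolongable (fun q => exists k, dual_terminal g q <= k%:E) (pbar T).
  move=> q /ltyP/(relint_prolongable fbar)[e e0 He].
  by exists e => //; apply/ltyP.
(* One trajectory serves both claims: it gives the remaining inequality between the values and
   attains the infimum. *)
have attain xi : exists x : nat -> 'rV[R]_n, x tau = xi /\
    primal_cost T L g tau x <= conjugate (dual_value T L g tau) xi.
  have le_mu p := le_conjugate_dual_value L g xi p tauT.
  case E : (conjugate _ _) => [mu| |]; last 2 first.
  - by exists (fun=> xi); rewrite leey.
  (* The value -oo is impossible since [pbar] has dual cost below +oo. *)
  - have : dual_cost T L g tau pbar <=
        (\sum_(tau.+1 <= t < T.+1) kbar t + kf)%:E.
      rewrite EFinD -sumEFin; apply: leeD => //.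
      rewrite big_nat_cond [leRHS]big_nat_cond; apply: lee_sum => t.
      by rewrite andbT => tT; apply: Hk.
    by have := le_mu pbar; rewrite E; case: (dual_cost _ _ _ _ _).
  apply: strong_duality Hk Hkf Kprol fprol _ => // p.
  have := le_mu p; rewrite E; case: (dual_cost _ _ _ _ _) => [d| |] //.
    by rewrite -EFinB !lee_fin; lra.
  by rewrite leey.
have valueE : conjugate (dual_value T L g tau) = primal_value T L g tau.
  apply/funext => xi; rewrite primal_valueE//; apply/le_anti/andP; split.
    apply: le_ereal_inf_tmp => _ [x /= xt <-].
    exact: conjugate_dual_value_le_primal.
  have [x [xt xle]] := attain xi.
  by apply: le_trans xle; apply: ereal_inf_lbound; exists x.
split=> // xi _; have [x [xt xle]] := attain xi; exists x; split=> //.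
apply/le_anti; rewrite -[in X in X && _]valueE xle /=.
by rewrite primal_valueE//; apply: ereal_inf_lbound; exists x.
Qed.
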